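(* For $i=1,2$ let $R_i$ be a unital ring whose additive group is finitely generated and torsion-free, let $\mathcal L_i\subseteq R_i$ be a full rank subgroup, and let $M_i\subseteq R_i^\times$ be a submonoid such that $\mathcal L_i$ is invariant under left multiplication by $M_i$. Assume that ${\rm span}_{\mathbb Z}(M_i)$ has finite index in $R_i$, that $M_i$ contains some integer $\kappa_i\in\mathbb Z\setminus\{0,1\}$, and that $\mathbb QR_i$ is a semisimple $\mathbb Q$-algebra. If the topological groupoids $(\mathbb QR_1\rtimes\langle M_1\rangle)\ltimes\overline{\mathcal L_1}$ and $(\mathbb QR_2\rtimes\langle M_2\rangle)\ltimes\overline{\mathcal L_2}$ are isomorphic, then there are $\mathbb Q$-algebra isomorphisms $\varphi_1\colon\mathbb QR_1\to\mathbb QR_2$ and $\varphi_2\colon\mathbb QR_2\to\mathbb QR_1$ with $\varphi_1(\langle M_1\rangle)\subseteq\langle M_2\rangle$ and $\varphi_2(\langle M_2\rangle)\subseteq\langle M_1\rangle$.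
   Context: $\mathbb QR=\mathbb Q\otimes_{\mathbb Z}R$; $R^\times$ is the monoid of left regular elements of $R$ (those $a$ with $x\mapsto ax$ injective); $\langle M\rangle$ is the subgroup of $(\mathbb QR)^*$ generated by $M$; full rank means the rank of $\mathcal L$ equals that of $R$. The constructible subgroups of $M\curvearrowright\mathcal L$ form the smallest family of subgroups of $\mathcal L$ containing $\mathcal L$ and closed under $C\mapsto aC$ and $C\mapsto\{x\in\mathcal L:ax\in C\}$ ($a\in M$); they have finite index and $\overline{\mathcal L}=\varprojlim_C\mathcal L/C$. $\mathbb QR\rtimes\langle M\rangle$ acts on $\mathbb QR$ by $(b,u).x=b+ux$; its restriction to $\mathcal L$ is a partial action extending uniquely to a partial action on $\overline{\mathcal L}$ by homeomorphisms between open sets; the groupoid is its partial transformation groupoid. Semisimple: trivial Jacobson radical. *)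

(* Defs.v *)
From HB Require Import structures.
From mathcomp Require Import all_boot all_order all_algebra all_field.
From mathcomp Require Import boolp classical_sets.

Set Implicit Arguments.
Unset Strict Implicit.
Unset Printing Implicit Defensive.

Import GRing.Theory.
Local Open Scope ring_scope.
Local Open Scope classical_set_scope.

(* Throughout, QR := Q (x) R is modelled by a finite-dimensional Q-algebra   *)
(* A : falgType rat, and R by a subring of A which is a finitely generated   *)
(* additive subgroup whose Q-span is A.              *)

Section Defs.
Variable A : falgType rat.

Definition Zspan_seq (s : seq A) : set A :=
  [set x | exists c : 'I_(size s) -> int, x = \sum_(i < size s) s`_i *~ c i].

Definition Zspan (P : set A) : set A :=
  [set x | exists s : seq A, (forall i, (i < size s)%N -> P s`_i) /\ Zspan_seq s x].

Definition lattice_ring (R : set A) : Prop :=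
  [/\ R 1, (forall x y, R x -> R y -> R (x - y)), (forall x y, R x -> R y -> R (x * y))
    & exists s : seq A, R = Zspan_seq s /\ (<<s>>%VS = fullv)].

Definition subgroup (L : set A) : Prop :=
  L 0 /\ (forall x y, L x -> L y -> L (x - y)).

(* full rank: rank L = rank R = dim_Q A, i.e. the Q-span of L is all of A *)
Definition full_rank (L : set A) : Prop :=
  exists t : seq A, (forall i, (i < size t)%N -> L t`_i) /\ (<<t>>%VS = fullv).

Definition left_regular (R : set A) (a : A) : Prop :=
  R a /\ (forall x, R x -> a * x = 0 -> x = 0).

Definition submonoid (M : set A) : Prop :=
  M 1 /\ (forall x y, M x -> M y -> M (x * y)).

Definition finite_index (H R : set A) : Prop :=
  exists reps : seq A, forall x, R x -> exists2 i, (i < size reps)%N & H (x - reps`_i).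

Definition left_ideal (I : set A) : Prop :=
  [/\ I 0, (forall x y, I x -> I y -> I (x + y)) & (forall a x, I x -> I (a * x))].

Definition maximal_left_ideal (I : set A) : Prop :=
  [/\ left_ideal I, ~ I 1 &
      forall J, left_ideal J -> ~ J 1 -> I `<=` J -> J = I].

Definition jacobson (x : A) : Prop :=
  forall I, maximal_left_ideal I -> I x.

Definition semisimple : Prop := forall x, jacobson x -> x = 0.

Inductive gen (M : set A) : A -> Prop :=
  | gen1 : gen M 1
  | genM m : M m -> gen M m
  | genV m : M m -> gen M m^-1
  | genMul x y : gen M x -> gen M y -> gen M (x * y).

Inductive constructible (L M : set A) : set A -> Prop :=
  | cons_L : constructible L M L
  | cons_mul a C : M a -> constructible L M C -> constructible L M [set a * c | c in C]
  | cons_pre a C : M a -> constructible L M C ->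
      constructible L M [set x | L x /\ C (a * x)].

(* Points of the profinite completion Lbar = lim_C L/C are encoded as       *)
(* compatible families xi : (set A) -> (set A) assigning to every            *)
(* constructible C a coset of C in L (and set0 to non-constructible sets).   *)
Definition iota (L M : set A) (x : A) : set A -> set A :=
  fun C => [set y | constructible L M C /\ C (y - x)].

Definition isLbar (L M : set A) (xi : set A -> set A) : Prop :=
  [/\ (forall C, ~ constructible L M C -> xi C = set0),
      (forall C, constructible L M C -> exists2 x, L x & xi C = iota L M x C)
    & (forall C C', constructible L M C -> constructible L M C' -> C' `<=` C ->
          xi C' `<=` xi C)].

(* basic neighbourhoods of the inverse limit topology: agreement on a finite *)
(* family of constructible subgroups                                         *)
Definition cfam (L M : set A) n (Cs : 'I_n -> set A) : Prop :=
  forall i, constructible L M (Cs i).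

Definition agree n (Cs : 'I_n -> set A) (xi eta : set A -> set A) : Prop :=
  forall i, eta (Cs i) = xi (Cs i).

Definition openL (L M : set A) (O : set (set A -> set A)) : Prop :=
  forall xi, O xi -> isLbar L M xi /\
    exists n (Cs : 'I_n -> set A), cfam L M Cs /\
      forall eta, isLbar L M eta -> agree Cs xi eta -> O eta.

Definition closureL (L M : set A) (D : set A) : set (set A -> set A) :=
  [set xi | isLbar L M xi /\
    forall n (Cs : 'I_n -> set A), cfam L M Cs ->
      exists2 x, D x & agree Cs xi (iota L M x)].

(* the group QR x| <M> : pairs (b,u) acting by x |-> b + u x *)
Definition inG (M : set A) (g : A * A) : Prop := gen M g.2.
Definition gmul (g h : A * A) : A * A := (g.1 + g.2 * h.1, g.2 * h.2).

Definition Dpart (L : set A) (g : A * A) : set A :=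
  [set x | L x /\ L (g.1 + g.2 * x)].

(* (Dom, th) is the (unique) extension of the partial action of            *)
(* QR x| <M> on L to a partial action on Lbar by homeomorphisms between     *)
(* open sets: the domain of th g is the closure of the domain on L, it is   *)
(* open, th g is continuous there with values in Lbar, and extends the      *)
(* action on L.  These conditions determine (Dom, th) uniquely.             *)
Definition extension (L M : set A) (Dom : A * A -> set (set A -> set A))
    (th : A * A -> (set A -> set A) -> (set A -> set A)) : Prop :=
  forall g, inG M g ->
  [/\ Dom g = closureL L M (Dpart L g),
      openL L M (Dom g),
      (forall xi, Dom g xi -> isLbar L M (th g xi)),
      (forall x, Dpart L g x -> th g (iota L M x) = iota L M (g.1 + g.2 * x))
    & (forall xi, Dom g xi -> forall C, constructible L M C ->
         exists n (Cs : 'I_n -> set A), cfam L M Cs /\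
           forall eta, Dom g eta -> agree Cs xi eta -> th g eta C = th g xi C)].

(* the partial transformation groupoid: arrows (g, xi) with xi in Dom g,   *)
(* source xi, range th g xi; topology = discrete x Lbar.                    *)
Definition arrows (M : set A) (Dom : A * A -> set (set A -> set A))
    : set ((A * A) * (set A -> set A)) :=
  [set gam | inG M gam.1 /\ Dom gam.1 gam.2].

Definition composable (th : A * A -> (set A -> set A) -> (set A -> set A))
    (gam eta : (A * A) * (set A -> set A)) : Prop :=
  gam.2 = th eta.1 eta.2.

Definition gpd_mul (gam eta : (A * A) * (set A -> set A)) :=
  (gmul gam.1 eta.1, eta.2).

Definition openArr (L M : set A) (Dom : A * A -> set (set A -> set A))
    (O : set ((A * A) * (set A -> set A))) : Prop :=
  O `<=` arrows M Dom /\
  forall gam, O gam -> exists n (Cs : 'I_n -> set A), cfam L M Cs /\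
    forall eta, Dom gam.1 eta -> agree Cs gam.2 eta -> O (gam.1, eta).

End Defs.

Definition gpd_iso (A1 A2 : falgType rat)
    (L1 M1 : set A1) (Dom1 : A1 * A1 -> set (set A1 -> set A1))
    (th1 : A1 * A1 -> (set A1 -> set A1) -> (set A1 -> set A1))
    (L2 M2 : set A2) (Dom2 : A2 * A2 -> set (set A2 -> set A2))
    (th2 : A2 * A2 -> (set A2 -> set A2) -> (set A2 -> set A2)) : Prop :=
  exists (Phi : (A1 * A1) * (set A1 -> set A1) -> (A2 * A2) * (set A2 -> set A2))
         (Psi : (A2 * A2) * (set A2 -> set A2) -> (A1 * A1) * (set A1 -> set A1)),
  [/\ (forall gam, arrows M1 Dom1 gam -> arrows M2 Dom2 (Phi gam) /\ Psi (Phi gam) = gam)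
      /\ (forall gam, arrows M2 Dom2 gam -> arrows M1 Dom1 (Psi gam) /\ Phi (Psi gam) = gam),
      (forall O, openArr L2 M2 Dom2 O ->
         openArr L1 M1 Dom1 [set gam | arrows M1 Dom1 gam /\ O (Phi gam)]),
      (forall O, openArr L1 M1 Dom1 O ->
         openArr L2 M2 Dom2 [set gam | arrows M2 Dom2 gam /\ O (Psi gam)]),
      (forall gam eta, arrows M1 Dom1 gam -> arrows M1 Dom1 eta -> composable th1 gam eta ->
         composable th2 (Phi gam) (Phi eta) /\ Phi (gpd_mul gam eta) = gpd_mul (Phi gam) (Phi eta))
    & (forall gam eta, arrows M2 Dom2 gam -> arrows M2 Dom2 eta -> composable th2 gam eta ->
         composable th1 (Psi gam) (Psi eta) /\ Psi (gpd_mul gam eta) = gpd_mul (Psi gam) (Psi eta))].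

Definition good_data (A : falgType rat) (R L M : set A) : Prop :=
  [/\ lattice_ring R,
      [/\ subgroup L, L `<=` R & full_rank L],
      [/\ submonoid M, M `<=` left_regular R & (forall a x, M a -> L x -> L (a * x))],
      finite_index (Zspan M) R
    & (exists k : int, [/\ k != 0, k != 1 & M (k%:~R)]) /\ semisimple A].

Definition Qalg_iso (A1 A2 : falgType rat) (f : A1 -> A2) : Prop :=
  [/\ linear f, monoid_morphism f & bijective f].

(* Main.v *)
From HB Require Import structures.
From mathcomp Require Import all_boot all_order all_algebra all_field.
From mathcomp Require Import boolp classical_sets filter.
Require Import Defs.

(** An isomorphism of the groupoids yields a cocycle [c (g, x)] with values in
    [A2 x| <M2>].  By compactness of the completion of [L1], the values
    [c (l, x)] on translations [l] only depend on [x] modulo one constructible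
    subgroup [C]; hence [rho l := c (l, 0)] is an injective homomorphism on a
    finite index subgroup [K] of [C].  An element of [A2 x| <M2>] that moves the
    image of [0] only slightly lifts to an arrow at [0] ending in [C], and so
    conjugates [rho K] into itself up to finite index.  For translations this
    shows that commutators with [rho K] are translations in [rho K], which the
    commuting linear parts [u] of [rho K] fix: [(1 - u') (1 - u) = 0].  Since
    <M2> spans [A2] and normalises the linear parts, [(1 - u) A2 (1 - u) = 0], so
    [u = 1] by semisimplicity.  Thus [rho] extends to an injective linear map
    [T : A1 -> A2] with [T (v x) = w T x], where [w] in <M2> is the linear part
    of [c (v, 0)].  The symmetric argument gives [dim A1 = dim A2], and
    [a |-> T (a T^-1(1))] is the required algebra isomorphism. *)

Set Implicit Arguments.
Unset Strict Implicit.
Unset Printing Implicit Defensive.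

Import Order.TTheory GRing.Theory Num.Theory.
Local Open Scope ring_scope.
Local Open Scope classical_set_scope.

(** * Subgroups of a rational algebra and common denominators *)

Lemma common_multiple (I : eqType) (s : seq I) (P : I -> nat -> Prop) :
  (forall i n m, P i n -> P i (n * m)%N) ->
  (forall i, i \in s -> exists2 n, (0 < n)%N & P i n) ->
  exists2 n, (0 < n)%N & forall i, i \in s -> P i n.
Proof.
move=> PM; elim: s => [|i s IHs] Ps; first by exists 1%N.
have [n n_gt0 Pn] := Ps i (mem_head i s).
have [m m_gt0 Pm] : exists2 m, (0 < m)%N & forall j, j \in s -> P j m.
  by apply: IHs => j js; apply: Ps; rewrite in_cons js orbT.
exists (n * m)%N; first by rewrite muln_gt0 n_gt0.
move=> j; rewrite in_cons => /predU1P[->|js]; first exact: PM.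
by rewrite mulnC; apply/PM/Pm.
Qed.

Section Subgroups.
Variables (A : falgType rat) (H : set A).
Hypothesis Hsub : subgroup H.

Lemma subgroup0 : H 0. Proof. by case: Hsub. Qed.

Lemma subgroupB x y : H x -> H y -> H (x - y).
Proof. by case: Hsub => _; apply. Qed.

Lemma subgroupN x : H x -> H (- x).
Proof. by move=> Hx; rewrite -sub0r; apply: subgroupB => //; apply: subgroup0. Qed.

Lemma subgroupD x y : H x -> H y -> H (x + y).
Proof. by move=> Hx Hy; rewrite -[y]opprK; apply/subgroupB/subgroupN. Qed.

Lemma subgroupMn x n : H x -> H (x *+ n).
Proof.
move=> Hx; elim: n => [|n IHn]; first by rewrite mulr0n; apply: subgroup0.
by rewrite mulrS; apply: subgroupD.
Qed.

Lemma subgroupMz x k : H x -> H (x *~ k).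
Proof.
by case: k => n Hx; rewrite ?NegzE ?mulrNz; [|apply: subgroupN]; apply: subgroupMn.
Qed.

Lemma subgroup_sum (I : Type) (r : seq I) (F : I -> A) :
  (forall i, H (F i)) -> H (\sum_(i <- r) F i).
Proof.
by move=> HF; apply: (big_ind H) => // [|x y]; [apply: subgroup0 | apply: subgroupD].
Qed.

Lemma full_rank_multiple a : full_rank H -> exists2 n, (0 < n)%N & H (a *+ n).
Proof.
case=> t [Ht tfull].
have -> : a = \sum_i coord (in_tuple t) i a *: (in_tuple t)`_i.
  by apply: coord_span; rewrite /= tfull memvf.
apply: (big_ind (fun x => exists2 n, (0 < n)%N & H (x *+ n))).
- by exists 1%N => //; rewrite mul0rn; apply: subgroup0.
- move=> x y [n n_gt0 Hx] [m m_gt0 Hy]; exists (n * m)%N; first by rewrite muln_gt0 n_gt0.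
  rewrite mulrnDl mulrnA [in X in _ + X]mulnC [in X in _ + X]mulrnA.
  by apply: subgroupD; apply: subgroupMn.
move=> i _; set q := coord _ _ _.
exists `|denq q|%N; first by rewrite absz_gt0 denq_neq0.
have -> : (q *: t`_i) *+ `|denq q| = t`_i *~ numq q.
  rewrite -scaler_nat scalerA -scaler_int numqE; congr (_ *: _).
  by rewrite mulrC -[in RHS](gez0_abs (denq_ge0 q)).
by apply/subgroupMz/Ht.
Qed.
End Subgroups.

(** * Units and the Jacobson radical *)

Section LeftRegular.
Variable A : falgType rat.

(** Injectivity on a finite-dimensional space gives surjectivity, hence [a * b = 1] for some [b];
    then [a * (b * a - 1) = 0] makes [b] a left inverse too. *)
Lemma mul_inj_unit (a : A) : (forall x, a * x = 0 -> x = 0) -> a \is a GRing.unit.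
Proof.
move=> a_inj.
have ker0 : lker (amull a) == 0%VS.
  apply/lker0P => x y; rewrite !lfunE /= => /eqP.
  by rewrite -subr_eq0 -mulrBr => /eqP/a_inj/subr0_eq.
have [b ab1] : exists b, a * b = 1.
  exists ((amull a)^-1%VF 1).
  by have := lker0_lfunVK ker0 1; rewrite lfunE.
apply/unitrP; exists b; split=> //.
by apply/subr0_eq/a_inj; rewrite mulrBr mulrA ab1 mul1r mulr1 subrr.
Qed.

(** If a maximal left ideal [I] missed [x], then [I + A x] would contain 1, say [1 = i + a x];
    multiplying by [x] on the left gives [x = x i + x a x = x i], which is in [I]. *)
Lemma jacobson_nilpotent (x : A) : (forall a, x * a * x = 0) -> jacobson x.
Proof.
move=> xAx I [[I0 ID IM] I1 Imax]; apply: contrapT => Ix.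
pose J := [set y | exists i a, I i /\ y = i + a * x].
have JI : I `<=` J by move=> i Ii; exists i, 0; rewrite mul0r addr0.
have lJ : left_ideal J.
  split; first exact: JI.
    move=> _ _ [i [a [Ii ->]]] [j [b [Ij ->]]]; exists (i + j), (a + b).
    by split; [apply: ID | rewrite mulrDl addrACA].
  move=> b _ [i [a [Ii ->]]]; exists (b * i), (b * a).
  by split; [apply: IM | rewrite mulrDr mulrA].
have [[i [a [Ii e1]]]|J1] := pselect (J 1).
  by apply: Ix; rewrite -[x]mulr1 e1 mulrDr mulrA xAx addr0; apply: IM.
by apply: Ix; rewrite -(Imax J lJ J1 JI); exists 0, 1; rewrite mul1r add0r.
Qed.
End LeftRegular.

(** * Consequences of the lattice data; constructible subgroups *)

Section Lattice.
Variables (A : falgType rat) (R L M : set A).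
Hypothesis data : good_data R L M.

Lemma good_subgroup : subgroup L. Proof. by case: data => _ []. Qed.

Lemma good_subring : subgroup R.
Proof. by case: data => -[R1 RB _ _] _ _ _ _; split=> //; rewrite -(subrr 1); apply: RB. Qed.

Lemma good_ring1 : R 1. Proof. by case: data => -[]. Qed.

Lemma good_sub x : L x -> R x. Proof. by case: data => _ [_ LR _] _ _ _; apply: LR. Qed.

Lemma good_act a x : M a -> L x -> L (a * x).
Proof. by case: data => _ _ [_ _ ML] _ _; apply: ML. Qed.

Lemma good_multiple a : exists2 n, (0 < n)%N & L (a *+ n).
Proof.
by apply: full_rank_multiple; [apply: good_subgroup | case: data => _ []].
Qed.

Lemma good_unit a : M a -> a \is a GRing.unit.
Proof.
case: data => _ _ [_ Mreg _] _ _ /Mreg[_ a_inj]; apply: mul_inj_unit => x ax0.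
have [n n_gt0 /good_sub Rxn] := good_multiple x.
have /eqP : x *+ n = 0 by apply: a_inj => //; rewrite mulrnAr ax0 mul0rn.
by rewrite -scaler_nat scaler_eq0 pnatr_eq0 -leqn0 leqNgt n_gt0 /= => /eqP.
Qed.

Lemma gen_unit u : gen M u -> u \is a GRing.unit.
Proof.
elim=> [|m /good_unit //|m /good_unit|x y _ Ux _ Uy]; first exact: unitr1.
  by rewrite unitrV.
by rewrite unitrMr.
Qed.

Lemma gen_inv u : gen M u -> gen M u^-1.
Proof.
elim=> [|m Mm|m Mm|x y gx IHx gy IHy]; first by rewrite invr1; apply: gen1.
- exact: genV.
- by rewrite invrK; apply: genM.
by rewrite invrM ?(gen_unit gx) ?(gen_unit gy) //; apply: genMul.
Qed.

Lemma ring_generators : exists s : seq A,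
  (forall x, R x <-> Zspan_seq s x) /\ (forall i, R s`_i).
Proof.
case: data => -[_ _ _ [s [Rs _]]] _ _ _ _; exists s; split=> [x|i]; first by rewrite Rs.
have [ile|ige] := ltnP i (size s); last by rewrite nth_default //; apply: (subgroup0 good_subring).
rewrite Rs; exists (fun j => (j == Ordinal ile)%:Z).
rewrite (bigD1 (Ordinal ile)) //= eqxx mulr1z big1 ?addr0 // => j /negPf->.
by rewrite mulr0z.
Qed.

Lemma ring_multiple a : exists2 n, (0 < n)%N & forall x, R x -> L (a * x *+ n).
Proof.
have [s [Rs _]] := ring_generators.
have [n n_gt0 Ln] : exists2 n, (0 < n)%N & forall x, x \in s -> L (a * x *+ n).
  apply: (common_multiple (P := fun x n => L (a * x *+ n))) => [x n m Lx|x _].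
    by rewrite mulrnA; apply: subgroupMn Lx; apply: good_subgroup.
  exact: good_multiple.
exists n => // x /Rs[c ->]; rewrite mulr_sumr -sumrMnl.
apply: (subgroup_sum good_subgroup) => i.
rewrite mulrzAr pmulrn mulrzAC -pmulrn; apply: (subgroupMz good_subgroup).
by apply/Ln/mem_nth.
Qed.

(** A proof principle for linear conditions: the integral span of [M] has finite index in [R], and
    [R] spans the algebra over the rationals, so [M] does too. *)
Lemma monoid_span (P : set A) :
  (forall q x y, P x -> P y -> P (q *: x + y)) -> M `<=` P -> forall a, P a.
Proof.
move=> Plin MP a.
have P1 : P 1 by apply: MP; case: data => _ _ [[]].
have P0 : P 0 by have := Plin (- 1) _ _ P1 P1; rewrite scaleN1r addNr.
have PZ q x : P x -> P (q *: x) by move=> Px; rewrite -[_ *: _]addr0; apply: Plin.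
have PB : subgroup P.
  by split=> // x y Px Py; rewrite addrC -scaleN1r; apply: Plin.
have PZs x : Zspan M x -> P x.
  case=> s [Ms [c ->]]; apply: (subgroup_sum PB) => i.
  by apply/(subgroupMz PB)/MP/Ms.
have [n n_gt0 /good_sub Ran] := good_multiple a.
case: data => _ _ _ [reps Preps] _.
(* There are more multiples of [a *+ n] than representatives: two of them share one, and their
   difference is a non-zero multiple of [a] in [P]. *)
have /choice[f fP] : forall j : 'I_(size reps).+1,
    exists i : 'I_(size reps), P (a *+ n *+ j - reps`_i).
  move=> j; have [i ilt /PZs Pi] := Preps _ (subgroupMn good_subring j Ran).
  by exists (Ordinal ilt).
have /injectiveP : ~ injective f by move/leq_card; rewrite !card_ord ltnn.
case/injectivePn => j [k jk fjk].
have := subgroupB PB (fP j) (fP k); rewrite fjk opprB addrA subrK.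
rewrite -!mulrnA -!scaler_nat -scalerBl => /(PZ ((n * j)%:R - (n * k)%:R)^-1).
rewrite scalerA mulVf ?scale1r // subr_eq0 eqr_nat eqn_mul2l negb_or -lt0n n_gt0 /=.
by apply: contraNneq jk => /ord_inj->.
Qed.

Lemma cons_subgroup C : constructible L M C -> subgroup C /\ C `<=` L.
Proof.
elim=> [|a B Ma _ [Bsub BL]|a B Ma _ [Bsub BL]]; first by split; first exact: good_subgroup.
  split; last by move=> _ [x Bx <-]; apply/good_act/BL.
  split; first by exists 0; [apply: subgroup0 | rewrite mulr0].
  by move=> _ _ [x Bx <-] [y By <-]; exists (x - y); [apply: subgroupB | rewrite mulrBr].
split; last by move=> x [].
split; first by rewrite /= mulr0; split; [apply: (subgroup0 good_subgroup) | apply: subgroup0].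
move=> x y [Lx Bx] [Ly By]; split; first by apply: (subgroupB good_subgroup).
by rewrite mulrBr; apply: subgroupB.
Qed.

(** Finite index of constructible subgroups in quantitative form; the integers for the successive
    steps multiply. *)
Lemma cons_multiple C : constructible L M C ->
  exists2 n, (0 < n)%N & forall x, R x -> C (x *+ n).
Proof.
elim=> [|a B Ma _ [n n_gt0 nB]|a B Ma _ [n n_gt0 nB]].
- by have [n n_gt0 Ln] := ring_multiple 1; exists n => // x /Ln; rewrite mul1r.
- have [m m_gt0 Lm] := ring_multiple a^-1.
  exists (m * n)%N; first by rewrite muln_gt0 m_gt0.
  move=> x /Lm/good_sub/nB Bx; exists (a^-1 * x *+ m *+ n) => //.
  by rewrite -mulrnA mulrnAr mulVKr // good_unit.
have [m m_gt0 Lm] := ring_multiple 1.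
exists (m * n)%N; first by rewrite muln_gt0 m_gt0.
move=> x Rx; have := Lm _ Rx; rewrite mul1r => Lxm.
split; first by rewrite mulrnA; apply: (subgroupMn good_subgroup).
by rewrite mulrnA mulrnAr; apply/nB/good_sub/good_act.
Qed.

(** Induction on [C] with [D] varying: [a B] meets [D] in [a (B & a^-1 D)], and [a^-1 B] meets [D]
    in [a^-1 (B & a D)], preimages being taken in [L]. *)
Lemma cons_cap C D : constructible L M C -> constructible L M D ->
  constructible L M (C `&` D).
Proof.
move=> cC; elim: cC D => [|a B Ma cB IHB|a B Ma cB IHB] D cD.
- by rewrite setIidr //; case: (cons_subgroup cD).
- rewrite (_ : _ `&` _ = [set a * c | c in B `&` [set x | L x /\ D (a * x)]]).
    by apply: cons_mul => //; apply/IHB/cons_pre.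
  apply/seteqP; split=> [_ [[x Bx <-] Dx]|_ [x [Bx [_ Dx]] <-]]; last by split; first by exists x.
  by exists x => //; split=> //; split=> //; apply: (cons_subgroup cB).2.
rewrite (_ : _ `&` _ = [set x | L x /\ (B `&` [set a * d | d in D]) (a * x)]).
  by apply: cons_pre => //; apply/IHB/cons_mul.
apply/seteqP; split=> [x [[Lx Bx] Dx]|x [Lx [Bx [d Dd ad]]]]; first by do 2!split=> //; exists x.
by split=> //; rewrite -(mulKr (good_unit Ma) x) -ad mulKr // good_unit.
Qed.

(** Continuity at 0 of multiplication by [u]: for [m] in [M] take the preimage of [C], for its
    inverse the image [m C]. *)
Lemma cons_gen u C : gen M u -> constructible L M C ->
  exists2 D, constructible L M D & forall x, D x -> C (u * x).
Proof.
move=> gu; elim: gu C => [|m Mm|m Mm|u1 u2 _ IH1 _ IH2] C cC.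
- by exists C => // x; rewrite mul1r.
- by exists [set x | L x /\ C (m * x)]; [apply: cons_pre | move=> x []].
- exists [set m * c | c in C]; first exact: cons_mul.
  by move=> _ [x Cx <-]; rewrite mulKr // good_unit.
have [D1 cD1 D1P] := IH1 C cC; have [D2 cD2 D2P] := IH2 D1 cD1.
by exists D2 => // x /D2P/D1P; rewrite mulrA.
Qed.
End Lattice.

(** * Topology and compactness of the completion *)

Lemma ultrafilter_cover (T : Type) (I : eqType) (U : set_system T) (s : seq I)
    (P : I -> set T) : UltraFilter U ->
  U [set p | exists2 i, i \in s & P i p] -> exists2 i, i \in s & U (P i).
Proof.
move=> ultraU; elim: s => [|i s IHs] Us.
  by have [p [i]] := filter_ex Us; rewrite in_nil.
have [UPi|UnPi] := in_ultra_setVsetC (P i) ultraU.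
  by exists i => //; apply: mem_head.
have [|j js UPj] := IHs.
  apply: filterS (filterI Us UnPi) => p [[j]].
  by rewrite in_cons => /predU1P[->|js] Pj nPi //; exists j.
by exists j => //; rewrite in_cons js orbT.
Qed.

Section Completion.
Variables (A : falgType rat) (R L M : set A).
Hypothesis data : good_data R L M.
Implicit Types (C : set A) (xi eta : set A -> set A).

Lemma iota_coset x y C : constructible L M C -> C (x - y) -> iota L M x C = iota L M y C.
Proof.
move=> cC Cxy; have [Csub _] := cons_subgroup data cC.
apply/seteqP; split=> z [_ Cz]; split=> //.
  by rewrite -(subrK x z) -addrA; apply: subgroupD.
by rewrite -(subrK y z) -addrA; apply: subgroupD => //; rewrite -opprB; apply: subgroupN.
Qed.

Lemma coset_iota x y C : constructible L M C -> iota L M x C = iota L M y C -> C (x - y).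
Proof.
move=> cC exy; have [Csub _] := cons_subgroup data cC.
by have : iota L M x C x; [split; rewrite ?subrr //; apply: subgroup0 | rewrite exy => -[]].
Qed.

Lemma lbar_iota x : L x -> isLbar L M (iota L M x).
Proof.
move=> Lx; split=> [C nC|C cC|C C' cC cC' sC y [_ Cy]].
- by apply/seteqP; split=> // y [].
- by exists x.
by split=> //; apply: sC.
Qed.

Lemma lbar_coset xi x C C' : isLbar L M xi -> constructible L M C ->
  constructible L M C' -> C `<=` C' -> xi C = iota L M x C -> xi C' = iota L M x C'.
Proof.
move=> [_ xiL xiS] cC cC' sC xiC; have [Csub _] := cons_subgroup data cC.
have [z Lz xiC'] := xiL C' cC'; rewrite xiC'; apply/esym/iota_coset => //.
have : xi C x by rewrite xiC; split; rewrite ?subrr //; apply: subgroup0.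
by move/(xiS _ _ cC' cC sC); rewrite xiC' => -[].
Qed.

Lemma cfam_lower n (Cs : 'I_n -> set A) : cfam L M Cs ->
  exists2 C, constructible L M C & forall i, C `<=` Cs i.
Proof.
elim: n Cs => [|n IHn] Cs cCs; first by exists L; [apply: cons_L | case].
have [|C cC CCs] := IHn (Cs \o lift ord0); first by move=> i; apply: cCs.
exists (Cs ord0 `&` C); first exact: (cons_cap data).
move=> i x [C0x Cx]; have [j ->|->] := unliftP ord0 i; [exact: CCs | exact: C0x].
Qed.

(** A finite family can be replaced by one constructible subgroup below all its members, so single
    subgroups give a neighbourhood basis. *)
Lemma cfam_agree n (Cs : 'I_n -> set A) : cfam L M Cs ->
  exists2 C, constructible L M C & forall xi eta, isLbar L M xi -> isLbar L M eta ->
    eta C = xi C -> agree Cs xi eta.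
Proof.
move=> cCs; have [C cC CCs] := cfam_lower cCs; exists C => // xi eta bxi beta eC i.
have [x Lx xiC] : exists2 x, L x & xi C = iota L M x C by case: bxi => _ /(_ C cC).
rewrite (lbar_coset bxi cC (cCs i) (CCs i) xiC).
by apply: (lbar_coset beta cC (cCs i) (CCs i)); rewrite eC.
Qed.

Lemma ring_cosets n : (0 < n)%N -> exists reps : seq A,
  forall x, R x -> exists2 r, r \in reps & exists2 y, R y & x - r = y *+ n.
Proof.
move=> n_gt0; have [s [Rs Rsi]] := ring_generators data.
pose rep (f : {ffun 'I_(size s) -> 'I_n}) := \sum_(i < size s) s`_i *+ f i.
exists [seq rep f | f <- enum {ffun 'I_(size s) -> 'I_n}] => x /Rs[c ->].
have cmodP i : (`|(c i %% n)%Z| < n)%N.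
  by rewrite -ltz_nat gez0_abs ?modz_ge0 ?ltz_pmod // -lt0n.
exists (rep [ffun i => Ordinal (cmodP i)]); first by apply: map_f; rewrite mem_enum.
exists (\sum_(i < size s) s`_i *~ (c i %/ n)%Z).
  by apply: (subgroup_sum (good_subring data)) => i; apply/(subgroupMz (good_subring data))/Rsi.
rewrite -sumrMnl -sumrB; apply: eq_bigr => i _; rewrite ffunE /=.
rewrite !pmulrn gez0_abs ?modz_ge0 -?lt0n //.
by rewrite {1}(divz_eq (c i) n) mulrzDr addrK mulrzA.
Qed.

(* An ultrafilter on pairs witnessing non-uniformity at every scale converges, *)
(* by finiteness of the quotients, to a point where local constancy fails.     *)
Lemma locally_constant_uniform (T : Type) (F : (set A -> set A) -> T) :
  (forall xi, isLbar L M xi -> exists2 C, constructible L M C &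
     forall eta, isLbar L M eta -> eta C = xi C -> F eta = F xi) ->
  exists2 C, constructible L M C &
     forall x y, L x -> L y -> C (x - y) -> F (iota L M x) = F (iota L M y).
Proof.
move=> Floc; apply: contrapT => noC.
pose B C := [set p : A * A | [/\ L p.1, L p.2, C (p.1 - p.2)
                               & F (iota L M p.1) <> F (iota L M p.2)]].
have properB : ProperFilter (filter_from (constructible L M) B).
  apply: filter_from_proper => [|C cC].
    apply: filter_from_filter => [|C D cC cD]; first by exists L; apply: cons_L.
    by exists (C `&` D); [apply: (cons_cap data) | move=> p [? ? [? ?] ?]].
  apply: contrapT => B0; apply: noC; exists C => // x y Lx Ly Cxy.
  by apply: contrapT => Fxy; apply: B0; exists (x, y).
have [U [ultraU BU]] := ultraFilterLemma properB.
have {}BU C : constructible L M C -> U (B C) by move=> cC; apply: BU; exists C.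
have Ucoset C : constructible L M C -> exists2 z, L z & U [set p | C (p.1 - z)].
  move=> cC; have [Csub _] := cons_subgroup data cC.
  have [n n_gt0 nC] := cons_multiple data cC; have [reps repsP] := ring_cosets n_gt0.
  pose P r := [set p : A * A | L p.1 /\ exists2 y, R y & p.1 - r = y *+ n].
  have [|r _ UPr] := @ultrafilter_cover _ _ U reps P ultraU.
    apply: filterS (BU C cC) => p [Lp _ _ _].
    have [r rr ry] := repsP _ (good_sub data Lp).
    by exists r.
  have [p0 [Lp0 [y0 Ry0 ey0]]] := filter_ex UPr.
  exists p0.1 => //; apply: filterS UPr => p [_ [y Ry ey]] /=.
  rewrite -(subrK r p.1) ey -addrA -[r - p0.1]opprB ey0 -mulrnBl.
  by apply/nC/(subgroupB (good_subring data)).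
(* The limit of the first coordinates along [U]: on each [C] it is the coset on which [U]
   concentrates. *)
pose xi C := [set y | constructible L M C /\ U [set p | C (p.1 - y)]].
have xiE C z : constructible L M C -> U [set p | C (p.1 - z)] -> xi C = iota L M z C.
  move=> cC Uz; have [Csub _] := cons_subgroup data cC.
  apply/seteqP; split=> y [_ Cy]; split=> //.
    have [p [Cpz Cpy]] := filter_ex (filterI Uz Cy).
    rewrite -(subrK p.1 y) -addrA; apply: subgroupD => //.
    by rewrite -opprB; apply: subgroupN.
  apply: filterS Uz => p Cpz /=.
  rewrite -(subrK z p.1) -addrA; apply: subgroupD => //.
  by rewrite -opprB; apply: subgroupN.
have bxi : isLbar L M xi.
  split=> [C nC|C cC|C C' cC cC' sC y [_ Cy]].
  - by apply/seteqP; split=> // y [].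
  - by have [z Lz Uz] := Ucoset C cC; exists z => //; apply: xiE.
  by split=> //; apply: filterS Cy => p /sC.
have [C cC FC] := Floc xi bxi; have [Csub _] := cons_subgroup data cC.
have [z Lz Uz] := Ucoset C cC; have xiC := xiE C z cC Uz.
have [p [Cpz [Lp1 Lp2 Cp Fp]]] := filter_ex (filterI Uz (BU C cC)).
apply: Fp; rewrite !FC //; first [exact: lbar_iota | rewrite xiC; apply: iota_coset => //].
by rewrite -(subrK p.1 p.2) -addrA; apply: subgroupD => //; rewrite -opprB; apply: subgroupN.
Qed.
End Completion.

(** * Extending additive maps to rational linear maps *)

Lemma mulrn_rat_inj (V : lmodType rat) n (x y : V) : (0 < n)%N -> x *+ n = y *+ n -> x = y.
Proof.
rewrite -!scaler_nat => n_gt0 /(scalerI _); apply.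
by rewrite pnatr_eq0 -lt0n.
Qed.

Lemma mulrn_rat_eq0 (V : lmodType rat) n (x : V) : (0 < n)%N -> x *+ n = 0 -> x = 0.
Proof. by move=> n_gt0 xn; apply: (mulrn_rat_inj n_gt0); rewrite mul0rn. Qed.

(** Put [T a = t (n a) / n] for a positive [n] with [n a] in [K]; additivity makes this independent
    of [n], and additive maps between rational vector spaces are linear. *)
Lemma rational_extension (A : falgType rat) (V : lmodType rat) (K : set A) (t : A -> V) :
  subgroup K -> (forall a, exists2 n, (0 < n)%N & K (a *+ n)) ->
  (forall x y, K x -> K y -> t (x + y) = t x + t y) ->
  exists T : A -> V, linear T /\ forall x, K x -> T x = t x.
Proof.
move=> Ksub Kmul tD.
have tn x n : K x -> t (x *+ n) = t x *+ n.
  move=> Kx; elim: n => [|n IHn].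
    rewrite !mulr0n; apply: (addrI (t 0)).
    by rewrite -tD ?addr0 //; apply: subgroup0.
  by rewrite !mulrS tD ?IHn //; apply: subgroupMn.
have /choice[N NP] a : exists n, (0 < n)%N /\ K (a *+ n).
  by have [n ? ?] := Kmul a; exists n.
pose T a := (N a)%:R^-1 *: t (a *+ N a).
have TE a n : K (a *+ n) -> T a *+ n = t (a *+ n).
  have [N_gt0 KN] := NP a; move=> Kan; apply: (mulrn_rat_inj N_gt0).
  rewrite -tn // -!mulrnA [in RHS]mulnC [in RHS]mulrnA tn // mulnC mulrnA; congr (_ *+ _).
  by rewrite -scaler_nat scalerA divff ?scale1r // pnatr_eq0 -lt0n.
have TB : zmod_morphism T.
  move=> x y; have [Nx KNx] := NP x; have [Ny KNy] := NP y.
  pose n := (N x * N y)%N; have n_gt0 : (0 < n)%N by rewrite muln_gt0 Nx.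
  have Kx : K (x *+ n) by rewrite mulrnA; apply: subgroupMn.
  have Ky : K (y *+ n) by rewrite /n mulnC mulrnA; apply: subgroupMn.
  have Kxy : K ((x - y) *+ n) by rewrite mulrnBl; apply: subgroupB.
  apply: (mulrn_rat_inj n_gt0); rewrite mulrnBl !TE //.
  by apply/eqP; rewrite eq_sym subr_eq -tD // -mulrnDl subrK.
exists T; split; last by move=> x Kx; have := TE x 1%N; rewrite !mulr1n; apply.
move=> q x y.
have T0 : T 0 = 0 by have := TB 0 0; rewrite !subrr.
have TN z : T (- z) = - T z by rewrite -[- z]sub0r TB T0 sub0r.
by rewrite -{1}(opprK y) TB TN opprK (rat_linear TB).
Qed.

(** * Affine representations of lattices *)

Section AffineRepresentation.
Variables (A1 A2 : falgType rat) (R2 L2 M2 : set A2).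
Hypothesis data2 : good_data R2 L2 M2.
Variables (K : set A1) (rho : A1 -> A2 * A2).
Hypothesis Ksub : subgroup K.
Hypothesis Kmul : forall a, exists2 n, (0 < n)%N & K (a *+ n).
Hypothesis rho_gen : forall x, K x -> gen M2 (rho x).2.
Hypothesis rhoD : forall x y, K x -> K y -> rho (x + y) = gmul (rho x) (rho y).

(** Conjugation by [g] takes [rho x] to [rho (v x)], but only after passing to a positive multiple
    of [x] that may depend on [x], as local constancy of the cocycle provides. *)
Definition intertwines (g : A2 * A2) (v : A1) : Prop :=
  forall x, K x -> exists2 n, (0 < n)%N &
    K (v * (x *+ n)) /\ gmul g (rho (x *+ n)) = gmul (rho (v * (x *+ n))) g.

Let e x := 1 - (rho x).2.

Let rho_unit x : K x -> (rho x).2 \is a GRing.unit.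
Proof. by move=> Kx; apply: (gen_unit data2); apply: rho_gen. Qed.

Let rho_linD x y : K x -> K y -> (rho (x + y)).2 = (rho x).2 * (rho y).2.
Proof. by move=> Kx Ky; rewrite rhoD. Qed.

(** As [K] is commutative, [rho x] commutes with the translation [rho y], so its linear part fixes
    the vector [(rho y).1]. *)
Let rho_translation x y : K x -> K y -> (rho y).2 = 1 -> e x * (rho y).1 = 0.
Proof.
move=> Kx Ky y1; have := rhoD Kx Ky; rewrite addrC rhoD // => -[+ _].
rewrite y1 mul1r addrC => /addrI exy.
by rewrite /e mulrBl mul1r -exy subrr.
Qed.

Lemma affine_translations (k : nat) (v : A1) :
  semisimple A2 -> (0 < k)%N -> intertwines (k%:R, 1) v ->
  (forall w, gen M2 w -> exists b v', intertwines (b, w) v') ->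
  forall x, K x -> exists2 n, (0 < n)%N & (rho (x *+ n)).2 = 1.
Proof.
move=> ss k_gt0 kv allw x Kx; have [n n_gt0 [Kvn eqg]] := kv x Kx.
set m := x *+ n in Kvn eqg *; have Km : K m by apply: subgroupMn.
exists n => //; rewrite -/m.
(* Conjugating by the translation by [k] shows that [rho (v * m - m)] is the translation by [k]
   times [e m]; every linear part fixes this vector, so [e y] kills it. *)
have e0 y : K y -> e y * e m = 0.
  move=> Ky; move: eqg; rewrite /gmul /= !mul1r => -[t_eq u_eq].
  rewrite mulr1 in u_eq.
  pose z := v * m - m; have Kz : K z by apply: subgroupB.
  have vmE : v * m = z + m by rewrite subrK.
  have z1 : (rho z).2 = 1.
    apply: (mulIr (rho_unit Km)); rewrite -rho_linD // -vmE mul1r; exact/esym.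
  have tz : (rho z).1 = e m * k%:R.
    have := rhoD Kz Km; rewrite -vmE => /(congr1 fst) /=; rewrite z1 mul1r => tvm.
    rewrite /e mulrBl mul1r; apply: (addIr ((rho m).2 * k%:R)); rewrite subrK.
    by apply: (addIr (rho m).1); rewrite t_eq -u_eq tvm addrAC.
  have := rho_translation Ky Kz z1; rewrite tz mulrA mulr_natr.
  exact: mulrn_rat_eq0.
(* Because [e (m *+ j) * e m = 0], multiplicativity of the linear parts becomes additivity of [e] on
   the multiples of [m]. *)
have eM j : e (m *+ j) = e m *+ j.
  elim: j => [|j IHj].
    rewrite !mulr0n /e; have K0 : K 0 by apply: subgroup0.
    suff -> : (rho 0).2 = 1 by rewrite subrr.
    by apply: (mulIr (rho_unit K0)); rewrite -rho_linD // addr0 mul1r.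
  rewrite !mulrSr -IHj [in LHS]/e rho_linD //; last exact: subgroupMn.
  have := e0 (m *+ j) (subgroupMn Ksub j Km).
  rewrite /e mulrBl mul1r mulrBr mulr1 => /subr0_eq->.
  by rewrite addrA subrK.
suff: e m = 0 by move/subr0_eq.
apply: ss; apply: jacobson_nilpotent.
apply: (monoid_span data2) => [q a b ha hb|w Mw].
  have -> z : z * (q *: a + b) * z = q *: (z * a * z) + z * b * z.
    by rewrite mulrDr mulrDl -scalerAr -scalerAl.
  by rewrite ha hb scaler0 addr0.
have gw := genM Mw; have uw := gen_unit data2 gw.
have [b [v' /(_ m Km)[j j_gt0 [Kv']]]] := allw _ (gen_inv data2 gw).
rewrite /gmul /= => -[_ weq].
apply: (mulrn_rat_eq0 j_gt0); rewrite -!mulrnAl -eM.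
(* The intertwining by [w^-1] moves [w] to the left of [e]; the product of two values of [e] that
   remains vanishes by [e0]. *)
have -> : e (m *+ j) * w = w * e (v' * (m *+ j)).
  rewrite /e mulrBl mulrBr mul1r mulr1; congr (_ - _).
  by apply: (mulrI (gen_unit data2 (gen_inv data2 gw))); rewrite mulKr // mulrA weq mulrVK.
by rewrite -mulrA e0 // mulr0.
Qed.

(** On [K1], where linear parts are trivial, [rho] is an additive map to translations; [T] is its
    rational extension, injective because [rho] has trivial kernel. *)
Lemma affine_extension (k : nat) (v : A1) (G : set A1) :
  semisimple A2 -> (0 < k)%N -> intertwines (k%:R, 1) v ->
  (forall w, gen M2 w -> exists b v', intertwines (b, w) v') ->
  (forall x, K x -> rho x = (0, 1) -> x = 0) ->
  (forall a, G a -> exists2 g, gen M2 g.2 & intertwines g a) ->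
  exists T : A1 -> A2, [/\ linear T, injective T &
    forall a, G a -> exists2 w, gen M2 w & forall x, T (a * x) = w * T x].
Proof.
move=> ss k_gt0 kv allw rho_inj GI.
have K0 : K 0 by apply: subgroup0.
pose K1 := [set x | K x /\ (rho x).2 = 1].
have rho0 : (rho 0).2 = 1.
  by apply: (mulIr (rho_unit K0)); rewrite -rho_linD // addr0 mul1r.
have K1sub : subgroup K1.
  split=> // x y [Kx x1] [Ky y1]; have Kxy : K (x - y) by apply: subgroupB.
  by split=> //; have := rho_linD Kxy Ky; rewrite subrK x1 y1 mulr1.
have K1mul a : exists2 n, (0 < n)%N & K1 (a *+ n).
  have [n n_gt0 Kn] := Kmul a.
  have [m m_gt0 rm] := affine_translations ss k_gt0 kv allw Kn.
  exists (n * m)%N; first by rewrite muln_gt0 n_gt0.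
  by rewrite mulrnA; split=> //; apply: subgroupMn.
have tD x y : K1 x -> K1 y -> (rho (x + y)).1 = (rho x).1 + (rho y).1.
  by move=> [Kx x1] [Ky _]; rewrite rhoD //= x1 mul1r.
have [T [Tlin TE]] := rational_extension K1sub K1mul tD.
have TB : zmod_morphism T by move=> x y; rewrite -scaleN1r addrC Tlin scaleN1r addrC.
pose Ta := GRing.isZmodMorphism.Build _ _ T TB.
pose T' : {additive A1 -> A2} := HB.pack T Ta.
have TMn x n : T (x *+ n) = T x *+ n := raddfMn T' n x.
exists T; split=> //.
  move=> x y Txy; apply/subr0_eq.
  have [n n_gt0 [Kn n1]] := K1mul (x - y).
  apply: (mulrn_rat_eq0 n_gt0); apply: rho_inj => //.
  by rewrite [LHS]surjective_pairing n1 -TE // TMn TB Txy subrr mul0rn.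
move=> a Ga; have [g gg ga] := GI a Ga; exists g.2 => // x.
have [n n_gt0 [Kn n1]] := K1mul x; have [m m_gt0 [Kam]] := ga _ Kn.
rewrite -!mulrnA => -[]; have nm_gt0 : (0 < n * m)%N by rewrite muln_gt0 n_gt0.
have [Knm nm1] : K1 (x *+ (n * m)) by rewrite mulrnA; apply: (subgroupMn K1sub).
rewrite -mulrnA in Kam; rewrite nm1 mulr1 => teq ueq.
(* The second components of the intertwining relation show that the image of [a * (x *+ (n * m))] is
   a translation as well; the first components then give the relation for [T]. *)
have am1 : (rho (a * (x *+ (n * m)))).2 = 1.
  by apply: (mulIr (gen_unit data2 gg)); rewrite mul1r.
move: teq; rewrite am1 mul1r addrC => /addIr; rewrite -!TE // => eqT.
by apply: (mulrn_rat_inj nm_gt0); rewrite -TMn -mulrnAr -eqT TMn mulrnAr.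
Qed.
End AffineRepresentation.

(** * The partial action on the completion *)

Section PartialAction.
Variables (A : falgType rat) (R L M : set A).
Variables (Dom : A * A -> set (set A -> set A)).
Variables (th : A * A -> (set A -> set A) -> (set A -> set A)).
Hypothesis data : good_data R L M.
Hypothesis ext : extension L M Dom th.
Implicit Types (g : A * A) (C : set A) (xi eta : set A -> set A).

Lemma dom_lbar g xi : inG M g -> Dom g xi -> isLbar L M xi.
Proof. by move=> Gg; case: (ext Gg) => -> _ _ _ _ []. Qed.

Lemma arrow_iota g x : gen M g.2 -> L x -> L (g.1 + g.2 * x) ->
  arrows M Dom (g, iota L M x) /\ th g (iota L M x) = iota L M (g.1 + g.2 * x).
Proof.
move=> Gg Lx Lgx; case: (ext Gg) => DomE _ _ thE _.
split; last exact: thE.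
split=> //=; rewrite DomE; split; first exact: lbar_iota.
by move=> n Cs cCs; exists x.
Qed.

(** The map [z |-> x' - w x + w z] sends [x] to [x'] and carries [x + C] into [L]. Approximating
    [xi] modulo [C & C1] thus gives points of [L] close to [xi] whose images lie in [L]. *)
Lemma affine_approx w xi C C1 x x' : isLbar L M xi -> constructible L M C ->
    constructible L M C1 -> (forall z, C z -> L (w * z)) -> L x' -> xi C = iota L M x C ->
  exists x1, [/\ L x1, L (x' - w * x + w * x1), xi C1 = iota L M x1 C1 & C (x1 - x)].
Proof.
move=> bxi cC cC1 wC Lx' xiC; have cI := cons_cap data cC cC1.
have [x1 Lx1 xi1] : exists2 x1, L x1 & xi (C `&` C1) = iota L M x1 (C `&` C1).
  by case: bxi => _ /(_ _ cI).
have Cx : C (x1 - x).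
  by apply: (coset_iota data cC); rewrite -xiC; apply/esym/(lbar_coset data bxi cI) => // z [].
exists x1; split=> //; last by apply: (lbar_coset data bxi cI) => // z [].
rewrite (_ : _ + _ = x' + w * (x1 - x)); last by rewrite mulrBr addrAC addrA.
by apply: (subgroupD (good_subgroup data)) => //; apply: wC.
Qed.

Lemma affine_dom w xi C x x' : gen M w -> isLbar L M xi -> constructible L M C ->
    (forall z, C z -> L (w * z)) -> L x' -> xi C = iota L M x C ->
  Dom (x' - w * x, w) xi.
Proof.
move=> gw bxi cC wC Lx' xiC; case: (ext (g := (x' - w * x, w)) gw) => -> _ _ _ _.
split=> // n Cs cCs; have [C1 cC1 C1s] := cfam_agree data cCs.
have [x1 [Lx1 Lgx1 xi1 _]] := affine_approx bxi cC cC1 wC Lx' xiC.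
by exists x1; [split | apply: C1s => //; apply: lbar_iota].
Qed.

(** By continuity the value modulo [C'] can be computed at an approximating point [x1], where it is
    [x' + w (x1 - x)] with [w (x1 - x)] in [C']. *)
Lemma affine_range w xi C C' x x' : gen M w -> isLbar L M xi -> constructible L M C ->
    constructible L M C' -> (forall z, C z -> C' (w * z)) -> L x' ->
    xi C = iota L M x C ->
  th (x' - w * x, w) xi C' = iota L M x' C'.
Proof.
move=> gw bxi cC cC' wC Lx' xiC.
have wCL z : C z -> L (w * z) by move/wC; apply: (cons_subgroup data cC').2.
have domxi := affine_dom gw bxi cC wCL Lx' xiC.
case: (ext (g := (x' - w * x, w)) gw) => DomE _ _ thE /(_ _ domxi _ cC')[n [Cs [cCs thC]]].
have [C1 cC1 C1s] := cfam_agree data cCs.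
have [x1 [Lx1 Lgx1 xi1 Cx1]] := affine_approx bxi cC cC1 wCL Lx' xiC.
have [[_ /= dx1] thx1] := arrow_iota (g := (x' - w * x, w)) gw Lx1 Lgx1.
rewrite -(thC _ dx1) ?thx1; last by apply: C1s => //; apply: lbar_iota.
apply: (iota_coset data) => //=.
rewrite (_ : _ - _ = w * (x1 - x)); first exact: wC.
by rewrite mulrBr addrAC [x' - _]addrC addrK addrC.
Qed.

Lemma unit_dom xi : isLbar L M xi -> Dom (0, 1) xi.
Proof.
move=> bxi; have [x Lx xiL] : exists2 x, L x & xi L = iota L M x L.
  by case: bxi => _ /(_ _ (cons_L _ _)).
have := affine_dom (gen1 M) bxi (cons_L _ _) _ Lx xiL.
by rewrite mul1r subrr; apply=> z; rewrite mul1r.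
Qed.

Lemma translation_dom l xi : L l -> isLbar L M xi -> Dom (l, 1) xi.
Proof.
move=> Ll bxi; have [x Lx xiL] : exists2 x, L x & xi L = iota L M x L.
  by case: bxi => _ /(_ _ (cons_L _ _)).
have Llx : L (l + x) by apply: (subgroupD (good_subgroup data)).
have := affine_dom (gen1 M) bxi (cons_L _ _) _ Llx xiL.
by rewrite mul1r addrK; apply=> z; rewrite mul1r.
Qed.

(** Membership of 0 in the domain is a closure condition, so choose [z] in [L] near 0 with [d + v z]
    in [L] and [v z] in [C]; by continuity [d + v z] lies in [C], hence so does [d]. *)
Lemma range_iota0 d v C : gen M v -> constructible L M C -> Dom (d, v) (iota L M 0) ->
  th (d, v) (iota L M 0) C = iota L M 0 C -> C d.
Proof.
move=> gv cC dom0 th0; have [Csub CL] := cons_subgroup data cC.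
case: (ext (g := (d, v)) gv) => DomE _ _ thE /(_ _ dom0 _ cC)[n [Cs [cCs thC]]].
have [C1 cC1 C1s] := cfam_agree data cCs; have [C2 cC2 C2C] := cons_gen data gv cC.
have cI := cons_cap data cC1 cC2.
have b0 := lbar_iota M (subgroup0 (good_subgroup data)).
move: (dom0); rewrite DomE => -[_ /(_ 1%N (fun=> C1 `&` C2) (fun=> cI))[z [Lz Lgz] /(_ ord0) agz]].
have Cvz : C (v * z).
  apply: C2C; have := coset_iota data cI agz.
  by rewrite subr0 => -[].
have [[_ /= dz] thz] := arrow_iota (g := (d, v)) gv Lz Lgz.
have : th (d, v) (iota L M z) C = iota L M 0 C.
  rewrite -th0; apply: thC => //; apply: C1s => //; first exact: lbar_iota.
  by apply: (lbar_coset data (lbar_iota M Lz) cI) => // y [].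
rewrite thz => /(coset_iota data cC) /=; rewrite subr0 => Cdvz.
by rewrite -(addrK (v * z) d); apply: subgroupB.
Qed.
End PartialAction.

(** * The cocycle of a groupoid isomorphism *)

Lemma gmulg1 (A : falgType rat) (g : A * A) : gmul g (0, 1) = g.
Proof. by case: g => b u; rewrite /gmul /= mulr0 addr0 mulr1. Qed.

Lemma gmulIr (A : falgType rat) (g g' h : A * A) :
  h.2 \is a GRing.unit -> gmul g h = gmul g' h -> g = g'.
Proof.
case: g g' h => [b u] [b' u'] [d v] /= Uv [+ /(mulIr Uv) uu'].
by rewrite uu' => /addIr->.
Qed.

Section GroupoidIsomorphism.
Variables (A1 A2 : falgType rat) (R1 L1 M1 : set A1) (R2 L2 M2 : set A2).
Variables (Dom1 : A1 * A1 -> set (set A1 -> set A1)).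
Variables (th1 : A1 * A1 -> (set A1 -> set A1) -> (set A1 -> set A1)).
Variables (Dom2 : A2 * A2 -> set (set A2 -> set A2)).
Variables (th2 : A2 * A2 -> (set A2 -> set A2) -> (set A2 -> set A2)).
Hypotheses (data1 : good_data R1 L1 M1) (data2 : good_data R2 L2 M2).
Hypotheses (ext1 : extension L1 M1 Dom1 th1) (ext2 : extension L2 M2 Dom2 th2).
Variable Phi : (A1 * A1) * (set A1 -> set A1) -> (A2 * A2) * (set A2 -> set A2).
Variable Psi : (A2 * A2) * (set A2 -> set A2) -> (A1 * A1) * (set A1 -> set A1).
Hypothesis PhiK : forall gam, arrows M1 Dom1 gam ->
  arrows M2 Dom2 (Phi gam) /\ Psi (Phi gam) = gam.
Hypothesis PsiK : forall gam, arrows M2 Dom2 gam ->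
  arrows M1 Dom1 (Psi gam) /\ Phi (Psi gam) = gam.
Hypothesis PhiC : forall O, openArr L2 M2 Dom2 O ->
  openArr L1 M1 Dom1 [set gam | arrows M1 Dom1 gam /\ O (Phi gam)].
Hypothesis PsiC : forall O, openArr L1 M1 Dom1 O ->
  openArr L2 M2 Dom2 [set gam | arrows M2 Dom2 gam /\ O (Psi gam)].
Hypothesis PhiM : forall gam eta, arrows M1 Dom1 gam -> arrows M1 Dom1 eta ->
  composable th1 gam eta ->
  composable th2 (Phi gam) (Phi eta) /\ Phi (gpd_mul gam eta) = gpd_mul (Phi gam) (Phi eta).
Hypothesis PsiM : forall gam eta, arrows M2 Dom2 gam -> arrows M2 Dom2 eta ->
  composable th2 gam eta ->
  composable th1 (Psi gam) (Psi eta) /\ Psi (gpd_mul gam eta) = gpd_mul (Psi gam) (Psi eta).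

Let i0 := iota L1 M1 0.
(** The point of the second completion corresponding to 0. It is not assumed to come from [L2],
    which is why domains and ranges were described for arbitrary points. *)
Let y0 := (Phi ((0, 1), i0)).2.
Let L1_0 : L1 0 := subgroup0 (good_subgroup data1).

Definition cocycle (g : A1 * A1) (x : A1) : A2 * A2 := (Phi (g, iota L1 M1 x)).1.

Lemma cocycle_gen g x : gen M1 g.2 -> L1 x -> L1 (g.1 + g.2 * x) -> gen M2 (cocycle g x).2.
Proof. by move=> gg Lx Lgx; have [/PhiK[[]]] := arrow_iota ext1 gg Lx Lgx. Qed.

Lemma cocycleM g h x : gen M1 g.2 -> gen M1 h.2 -> L1 x -> L1 (h.1 + h.2 * x) ->
    L1 (g.1 + g.2 * (h.1 + h.2 * x)) ->
  cocycle (gmul g h) x = gmul (cocycle g (h.1 + h.2 * x)) (cocycle h x).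
Proof.
move=> gg gh Lx Lhx Lghx.
have [ah th_h] := arrow_iota ext1 gh Lx Lhx; have [ag _] := arrow_iota ext1 gg Lhx Lghx.
have [|_ /(congr1 fst) //] := PhiM ag ah.
by rewrite /composable /= th_h.
Qed.

Lemma cocycle1 x : L1 x -> cocycle (0, 1) x = (0, 1).
Proof.
move=> Lx; have x1 : 0 + 1 * x = x by rewrite mul1r add0r.
have Lx1 : L1 (0 + 1 * x) by rewrite x1.
have := @cocycleM (0, 1) (0, 1) x (gen1 M1) (gen1 M1) Lx Lx1.
rewrite /= !x1 gmulg1 => /(_ Lx) cc; have gc := cocycle_gen (g := (0, 1)) (gen1 M1) Lx Lx1.
apply: (gmulIr (gen_unit data2 gc)); rewrite -cc.
by rewrite /gmul /= add0r !mul1r -surjective_pairing.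
Qed.

(** Composing on the right with the unit at 0 shows that the image has source [y0]. *)
Lemma phi_iota0 g : gen M1 g.2 -> L1 g.1 -> Phi (g, i0) = (cocycle g 0, y0).
Proof.
move=> gg Lg.
have [a1 th_1] : arrows M1 Dom1 ((0, 1), i0) /\ th1 (0, 1) i0 = i0.
  have [] := arrow_iota ext1 (g := (0, 1)) (gen1 M1) L1_0.
    by rewrite /= add0r mulr0.
  by rewrite /= add0r mulr0.
have [ag _] : arrows M1 Dom1 (g, i0) /\ th1 g i0 = iota L1 M1 (g.1 + g.2 * 0).
  by apply: (arrow_iota ext1) => //; rewrite mulr0 addr0.
have [|_] := PhiM ag a1; first by rewrite /composable /= th_1.
rewrite /gpd_mul /= gmulg1 => e.
by rewrite [LHS]surjective_pairing; congr pair; rewrite e.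
Qed.

Let phi_unit : Phi ((0, 1), i0) = ((0, 1), y0).
Proof. by rewrite phi_iota0 ?cocycle1 //; apply: gen1. Qed.

Let arrow_unit : arrows M1 Dom1 ((0, 1), i0).
Proof.
by have [] := arrow_iota ext1 (g := (0, 1)) (gen1 M1) L1_0; rewrite //= add0r mulr0.
Qed.

Let arrow_y0 : arrows M2 Dom2 ((0, 1), y0).
Proof. by have [] := PhiK arrow_unit; rewrite phi_unit. Qed.

Let psi_unit : Psi ((0, 1), y0) = ((0, 1), i0).
Proof. by have [_] := PhiK arrow_unit; rewrite phi_unit. Qed.

Let y0_bar : isLbar L2 M2 y0.
Proof. by have [g2 /(dom_lbar ext2 g2)] := arrow_y0. Qed.

Let th_y0 : th2 (0, 1) y0 = y0.
Proof.
have [|] := PhiM arrow_unit arrow_unit.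
  rewrite /composable /=.
  by have [] := arrow_iota ext1 (g := (0, 1)) (gen1 M1) L1_0; rewrite /= ?add0r ?mulr0.
by rewrite /composable phi_unit /=.
Qed.

(** The group is discrete, so the arrows with a given group component form an open set, whose
    preimage under [Phi] is open. *)
Lemma cocycle_locally_constant g xi : inG M1 g -> Dom1 g xi ->
  exists2 C, constructible L1 M1 C &
    forall eta, Dom1 g eta -> eta C = xi C -> (Phi (g, eta)).1 = (Phi (g, xi)).1.
Proof.
move=> Gg Dxi; have agx : arrows M1 Dom1 (g, xi) by split.
pose O := [set gam | arrows M2 Dom2 gam /\ gam.1 = (Phi (g, xi)).1].
have [|_ /(_ (g, xi))[|n [Cs [cCs CsO]]]] := @PhiC O.
- split=> [gam []//|gam [[Ggam Dgam] gam1]]; exists 0%N, (fun=> set0).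
  by split=> [[]//|eta Deta _]; split.
- by split=> //; split=> //; apply: (PhiK agx).1.
have [C cC CCs] := cfam_agree data1 cCs; exists C => // eta Deta eC.
have [] := CsO eta Deta (CCs _ _ (dom_lbar ext1 Gg Dxi) (dom_lbar ext1 Gg Deta) eC).
by move=> _ [].
Qed.

(** A translation by an element of [L1] is defined on the whole completion, so compactness turns
    local constancy into uniformity. *)
Lemma cocycle_uniform l : L1 l -> exists2 C, constructible L1 M1 C &
  forall x y, L1 x -> L1 y -> C (x - y) -> cocycle (l, 1) x = cocycle (l, 1) y.
Proof.
move=> Ll; apply: (locally_constant_uniform data1 (F := fun xi => (Phi ((l, 1), xi)).1)).
move=> xi bxi.
have [C cC CP] :=
  cocycle_locally_constant (g := (l, 1)) (gen1 M1) (translation_dom data1 ext1 Ll bxi).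
by exists C => // eta beta; apply/CP/(translation_dom data1 ext1).
Qed.

(** By continuity, [Psi] sends the unit at the endpoint of [(g, y0)] to an arrow whose source is
    close to 0; that source is the endpoint of [Psi (g, y0)], which itself starts at 0. *)
Lemma cocycle_lift C : constructible L1 M1 C ->
  exists2 C2, constructible L2 M2 C2 &
    forall g, inG M2 g -> Dom2 g y0 -> th2 g y0 C2 = y0 C2 ->
      exists d v, [/\ gen M1 v, C d & cocycle (d, v) 0 = g].
Proof.
move=> cC; pose O := [set gam | arrows M1 Dom1 gam /\ gam.2 C = i0 C].
have [|_ /(_ ((0, 1), y0))[|n [Cs [cCs CsO]]]] := @PsiC O.
- split=> [gam []//|gam [[Ggam Dgam] gamC]]; exists 1%N, (fun=> C).
  by split=> // eta Deta /(_ ord0) /= etaC; split; rewrite //= etaC.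
- by split=> //; rewrite psi_unit; split.
have [C2 cC2 C2s] := cfam_agree data2 cCs; exists C2 => // g Gg Dg thg.
have br : isLbar L2 M2 (th2 g y0) by case: (ext2 Gg) => _ _ /(_ _ Dg).
have Dr := unit_dom data2 ext2 br.
have [_ [_ rC]] := CsO _ Dr (C2s _ _ y0_bar br thg).
have ag : arrows M2 Dom2 (g, y0) by split.
have ar : arrows M2 Dom2 ((0, 1), th2 g y0) by split=> //; apply: gen1.
have [|_] := PsiM ag arrow_y0; first by rewrite /composable /= th_y0.
rewrite psi_unit /gpd_mul /= gmulg1 => /(congr1 snd) /= sg.
have [//|rg _] := PsiM ar ag; have [[G1 D1] PhiPsi] := PsiK ag.
move: rg sg G1 D1 PhiPsi; rewrite /composable.
case: (Psi (g, y0)) => -[d v] xi /= rg sg; rewrite sg in rg *; move=> G1 D1 PhiPsi.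
exists d, v; split=> //; last by rewrite /cocycle PhiPsi.
by apply: (range_iota0 data1 ext1 G1 cC D1); rewrite -rg.
Qed.

Definition uniform_for (C : set A1) : set A1 :=
  [set l | L1 l /\ forall x y, L1 x -> L1 y -> C (x - y) ->
                     cocycle (l, 1) x = cocycle (l, 1) y].

Lemma uniform_for_seq (s : seq A1) : (forall l, l \in s -> L1 l) ->
  exists2 C, constructible L1 M1 C & forall l, l \in s -> uniform_for C l.
Proof.
elim: s => [|l s IHs] Ls; first by exists L1; [apply: cons_L|].
have Ll : L1 l by apply: Ls; apply: mem_head.
have [|C cC CP] := IHs; first by move=> k ks; apply: Ls; rewrite in_cons ks orbT.
have [C' cC' C'P] := cocycle_uniform Ll.
exists (C `&` C'); first exact: (cons_cap data1).
move=> k; rewrite in_cons => /predU1P[->|/CP[Lk kP]]; split=> // x y Lx Ly [Cxy C'xy].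
  exact: C'P.
exact: kP.
Qed.

(** The cocycle identity writes the value of [l - l'] at [z] as that of [l] at [z - l'] times the
    inverse of that of [l'] at [z - l']; shifting by [l'] preserves differences. *)
Lemma uniform_for_subgroup C : constructible L1 M1 C -> subgroup (uniform_for C).
Proof.
move=> cC; have Lsub := good_subgroup data1.
split; first by split=> // x y Lx Ly _; rewrite !cocycle1.
move=> l l' [Ll lP] [Ll' l'P]; have Lll' : L1 (l - l') by apply: subgroupB.
split=> // x y Lx Ly Cxy.
have key z : L1 z ->
    cocycle (l, 1) (z - l') = gmul (cocycle (l - l', 1) z) (cocycle (l', 1) (z - l')).
  move=> Lz; have Lzl' : L1 (z - l') by apply: subgroupB.
  have zE : l' + 1 * (z - l') = z by rewrite mul1r addrC subrK.
  have := @cocycleM (l - l', 1) (l', 1) (z - l') (gen1 M1) (gen1 M1) Lzl'.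
  rewrite /= zE mul1r {1}/gmul /= !mul1r subrK; apply=> //.
  exact: subgroupD.
have Lxl' : L1 (x - l') by apply: subgroupB.
have Lyl' : L1 (y - l') by apply: subgroupB.
have Cxy' : C (x - l' - (y - l')) by rewrite opprB addrA subrK.
apply: (@gmulIr _ _ _ (cocycle (l', 1) (x - l'))).
  apply: (gen_unit data2); apply: cocycle_gen => //=; first exact: gen1.
  by rewrite mul1r addrC subrK.
by rewrite -key // (l'P _ _ Lxl' Lyl' Cxy') -key //; apply: lP.
Qed.

(** [L1] contains some [N R1]; uniformity for its finitely many generators needs only one [C], and
    the subgroup property extends it to all of [N R1]. *)
Lemma uniform_neighbourhood : exists2 C, constructible L1 M1 C &
  forall a, exists2 n, (0 < n)%N & uniform_for C (a *+ n).
Proof.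
have [s [Rs Rsi]] := ring_generators data1.
have [N N_gt0 NL] := ring_multiple data1 1.
have [|C cC CP] := @uniform_for_seq [seq x *+ N | x <- s].
  by move=> _ /mapP[x /(nthP 0)[i _ <-] ->]; have := NL _ (Rsi i); rewrite mul1r.
have Usub := uniform_for_subgroup cC.
exists C => // a; have [n n_gt0 /(good_sub data1) Ran] := good_multiple data1 a.
exists (n * N)%N; first by rewrite muln_gt0 n_gt0.
rewrite mulrnA; move/Rs: Ran => [c ->]; rewrite -sumrMnl.
apply: (subgroup_sum Usub) => i; rewrite pmulrn mulrzAC -pmulrn.
by apply: (subgroupMz Usub); apply: CP; apply: map_f; apply: mem_nth.
Qed.

(** Evaluate the cocycle at 0 on both sides of [(d, v) (l, 1) = (v l, 1) (d, v)]. For [l] close to 0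
    the value of [(d, v)] at [l] equals that at 0; as [d] is in [C], the value of [(v l, 1)] at [d]
    equals that at 0. *)
Lemma cocycle_intertwines C d v : constructible L1 M1 C ->
    (forall a, exists2 n, (0 < n)%N & uniform_for C (a *+ n)) -> gen M1 v -> C d ->
  intertwines (C `&` uniform_for C) (fun l => cocycle (l, 1) 0) (cocycle (d, v) 0) v.
Proof.
move=> cC Umul gv Cd x [Cx Ux]; have Lsub := good_subgroup data1.
have [Csub CL] := cons_subgroup data1 cC; have Usub := uniform_for_subgroup cC.
have Ld : L1 d by apply: CL.
have Ld0 : L1 (d + v * 0) by rewrite mulr0 addr0.
have [[Gh Dh] _] := arrow_iota ext1 (g := (d, v)) gv L1_0 Ld0.
have [Ch cCh ChP] := cocycle_locally_constant Gh Dh.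
have [D cD DC] := cons_gen data1 gv cC.
have [n n_gt0 nDC] := cons_multiple data1 (cons_cap data1 cD cCh).
have [m m_gt0 Um] := Umul (v * x).
have Rx : R1 x by apply/(good_sub data1)/CL.
exists (n * m)%N; first by rewrite muln_gt0 n_gt0.
set l := x *+ (n * m).
have [Dl Chl] : (D `&` Ch) l.
  by rewrite /l mulnC mulrnA; apply: nDC; apply: (subgroupMn (good_subring data1)).
have Cvl : C (v * l) by apply: DC.
have Uvl : uniform_for C (v * l).
  by rewrite /l mulnC mulrnA mulrnAr mulrnAr; apply: (subgroupMn Usub).
have Ll : L1 l by apply: (subgroupMn Lsub); apply: CL.
have Lvl : L1 (v * l) by apply: CL.
have Ldvl : L1 (d + v * l) by apply: subgroupD.
split=> //.
have hl : cocycle (d, v) l = cocycle (d, v) 0.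
  apply: ChP; first by have [[]] := arrow_iota ext1 (g := (d, v)) gv Ll Ldvl.
  by apply: (iota_coset data1) => //; rewrite subr0.
rewrite -{1}hl; have := @cocycleM (d, v) (l, 1) 0 gv (gen1 M1) L1_0.
rewrite /= mulr0 addr0 => <- //.
have <- : cocycle (v * l, 1) d = cocycle (v * l, 1) 0.
  by apply: Uvl.2 => //; rewrite subr0.
have := @cocycleM (v * l, 1) (d, v) 0 (gen1 M1) gv L1_0.
rewrite /= mulr0 addr0 mul1r => <- //; last by rewrite addrC.
by rewrite /gmul /= !mul1r mulr1 addrC.
Qed.

Lemma linear_intertwiner : exists T : A1 -> A2, [/\ linear T, injective T &
  forall v, gen M1 v -> exists2 w, gen M2 w & forall x, T (v * x) = w * T x].
Proof.
have [C cC Umul] := uniform_neighbourhood.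
have [Csub CL] := cons_subgroup data1 cC; have Usub := uniform_for_subgroup cC.
pose K := C `&` uniform_for C; pose rho l := cocycle (l, 1) 0.
have Ksub : subgroup K.
  split; first by split; apply: subgroup0.
  by move=> x y [Cx Ux] [Cy Uy]; split; apply: subgroupB.
have Kmul a : exists2 n, (0 < n)%N & K (a *+ n).
  have [n n_gt0 Un] := Umul a; have [m m_gt0 mC] := cons_multiple data1 cC.
  exists (n * m)%N; first by rewrite muln_gt0 n_gt0.
  rewrite mulrnA; split; last exact: subgroupMn.
  by apply/mC/(good_sub data1)/Un.1.
have rho_gen x : K x -> gen M2 (rho x).2.
  move=> [Cx _]; apply: cocycle_gen => //=; first exact: gen1.
  by rewrite mulr0 addr0; apply: CL.
have rhoD x y : K x -> K y -> rho (x + y) = gmul (rho x) (rho y).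
  move=> [Cx Ux] [Cy Uy]; have Lx := CL _ Cx; have Ly := CL _ Cy.
  have Lxy : L1 (x + y) by apply: (subgroupD (good_subgroup data1)).
  have := @cocycleM (x, 1) (y, 1) 0 (gen1 M1) (gen1 M1) L1_0.
  rewrite /= mulr0 addr0 mul1r {1}/gmul /= !mul1r => /(_ Ly Lxy); rewrite /rho => ->.
  by congr gmul; apply: Ux.2 => //; rewrite subr0.
have [C2 cC2 C2P] := cocycle_lift cC; have [C2sub C2L] := cons_subgroup data2 cC2.
have lift g : inG M2 g -> Dom2 g y0 -> th2 g y0 C2 = y0 C2 -> exists v, intertwines K rho g v.
  move=> Gg Dg thg; have [d [v [gv Cd <-]]] := C2P g Gg Dg thg.
  by exists v; apply: cocycle_intertwines.
have [_ /(_ _ cC2)[x2 Lx2 y0C2] _] := y0_bar.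
have [k k_gt0 /(_ _ (good_ring1 data2)) kC2] := cons_multiple data2 cC2.
(* Translation by an element of [C2] keeps [y0] in its coset, represented by [x2], so it lifts. *)
have [v kv] : exists v, intertwines K rho (k%:R, 1) v.
  have gE : (k%:R, 1) = (k%:R + x2 - 1 * x2, 1) :> A2 * A2 by rewrite mul1r addrK.
  have Lk : L2 (k%:R + x2) by apply: (subgroupD (good_subgroup data2)) => //; apply: C2L.
  apply: lift; first exact: gen1.
    rewrite gE; apply: (affine_dom data2 ext2 (gen1 M2) y0_bar cC2) => // z.
    by rewrite mul1r; apply: C2L.
  rewrite gE (affine_range data2 ext2 (gen1 M2) y0_bar cC2 cC2 _ Lk y0C2).
    by rewrite y0C2; apply: (iota_coset data2) => //; rewrite addrK.
  by move=> z; rewrite mul1r.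
apply: (affine_extension data2 Ksub Kmul rho_gen rhoD _ k_gt0 kv).
- by case: data2 => _ _ _ _ [].
- move=> w gw; have [D cD DC2] := cons_gen data2 gw cC2.
  have [_ /(_ _ cD)[x Lx y0D] _] := y0_bar.
  (* The affine map with linear part [w] taking the approximation [x] of [y0] to [x2] fixes [y0]
     modulo [C2]. *)
  exists (x2 - w * x); apply: lift => //.
    by apply: (affine_dom data2 ext2 gw y0_bar cD) => // z /DC2; apply: C2L.
  by rewrite (affine_range data2 ext2 gw y0_bar cD cC2 DC2 Lx2 y0D).
- move=> x [Cx Ux] rx; have Lx := CL _ Cx.
  have ax : arrows M1 Dom1 ((x, 1), i0).
    have [] := arrow_iota ext1 (g := (x, 1)) (gen1 M1) L1_0; last by [].
    by rewrite /= mulr0 addr0.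
  have [_] := PhiK ax; rewrite phi_iota0 //; last exact: gen1.
  by rewrite -/(rho x) rx psi_unit => -[].
(* The arrow of [(0, a)] at 0 ends at 0, which lies in [C], so it supplies the intertwiner
   directly. *)
move=> a ga; exists (cocycle (0, a) 0).
  by apply: cocycle_gen => //=; rewrite mulr0 addr0.
by apply: cocycle_intertwines => //; apply: subgroup0.
Qed.
End GroupoidIsomorphism.

(** * Algebra isomorphisms from linear intertwiners *)

Lemma linear_injection_dim (A1 A2 : falgType rat) (T : A1 -> A2) :
  linear T -> injective T -> (\dim {:A1} <= \dim {:A2})%N.
Proof.
move=> Tlin Tinj; pose Tl := GRing.isLinear.Build _ _ _ _ T Tlin.
pose T' : {linear A1 -> A2} := HB.pack T Tl.
rewrite -(@limg_dim_eq _ _ _ (linfun T') fullv) ?dimvS ?subvf //.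
rewrite (_ : lker _ = 0%VS) ?capv0 //.
by apply/eqP/lker0P => x y; rewrite !lfunE => /Tinj.
Qed.

Lemma linear_injection_bij (A1 A2 : falgType rat) (T : A1 -> A2) :
  linear T -> injective T -> (\dim {:A2} <= \dim {:A1})%N -> bijective T.
Proof.
move=> Tlin Tinj dimA; pose Tl := GRing.isLinear.Build _ _ _ _ T Tlin.
pose T' : {linear A1 -> A2} := HB.pack T Tl.
have ker0 : lker (linfun T') == 0%VS.
  by apply/lker0P => x y; rewrite !lfunE => /Tinj.
have img : limg (linfun T') = fullv.
  by apply/eqP; rewrite eqEdim subvf /= limg_dim_eq // (eqP ker0) capv0.
exists ((linfun T')^-1)%VF => x; first by have := lker0_lfunK ker0 x; rewrite lfunE.
by have := @limg_lfunVK _ _ _ (linfun T') x; rewrite img memvf lfunE; apply.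
Qed.

(** The relation [T (v x) = w T x] identifies [w] as [phi v]; by linearity [T (a x) = phi a * T x]
    for all [a], and [x = b * S 1] gives multiplicativity. *)
Lemma intertwiner_isomorphism (A1 A2 : falgType rat) (R1 L1 M1 : set A1) (M2 : set A2)
    (T : A1 -> A2) :
  good_data R1 L1 M1 -> linear T -> bijective T ->
  (forall v, gen M1 v -> exists2 w, gen M2 w & forall x, T (v * x) = w * T x) ->
  exists2 phi : A1 -> A2, Qalg_iso phi & forall u, gen M1 u -> gen M2 (phi u).
Proof.
move=> data1 Tlin [S ST TS] Tgen; pose phi a := T (a * S 1).
have phi_gen u : gen M1 u -> gen M2 (phi u) /\ forall x, T (u * x) = phi u * T x.
  by move=> /Tgen[w gw wT]; rewrite /phi wT TS mulr1.
have phi_lin : linear phi by move=> q x y; rewrite /phi mulrDl -scalerAl Tlin.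
have phiT a x : T (a * x) = phi a * T x.
  apply: (monoid_span data1 (P := fun a => T (a * x) = phi a * T x)).
    by move=> q y z Ty Tz; rewrite mulrDl -scalerAl Tlin Ty Tz phi_lin mulrDl scalerAl.
  by move=> m /genM/phi_gen[].
have phi1 : phi 1 = 1 by rewrite /phi mul1r TS.
have phiM a b : phi (a * b) = phi a * phi b by rewrite /phi -mulrA phiT.
have phi_inj : injective phi.
  move=> x y exy; apply: (can_inj ST); rewrite -[x]mulr1 -[y]mulr1 !phiT.
  by rewrite exy.
exists phi; last by move=> u /phi_gen[].
split=> //; apply: linear_injection_bij => //; apply: (@linear_injection_dim _ _ S).
  by move=> q x y; apply: (can_inj ST); rewrite Tlin !TS.
exact: can_inj TS.
Qed.

Theorem theorem5p19 (A1 A2 : falgType rat) (R1 L1 M1 : set A1) (R2 L2 M2 : set A2)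
  (Dom1 : A1 * A1 -> set (set A1 -> set A1))
  (th1 : A1 * A1 -> (set A1 -> set A1) -> (set A1 -> set A1))
  (Dom2 : A2 * A2 -> set (set A2 -> set A2))
  (th2 : A2 * A2 -> (set A2 -> set A2) -> (set A2 -> set A2)) :
  good_data R1 L1 M1 -> good_data R2 L2 M2 ->
  extension L1 M1 Dom1 th1 -> extension L2 M2 Dom2 th2 ->
  gpd_iso L1 M1 Dom1 th1 L2 M2 Dom2 th2 ->
  exists (phi1 : A1 -> A2) (phi2 : A2 -> A1),
    [/\ Qalg_iso phi1, Qalg_iso phi2,
        (forall u, gen M1 u -> gen M2 (phi1 u))
      & (forall u, gen M2 u -> gen M1 (phi2 u))].
Proof.
move=> data1 data2 ext1 ext2 [Phi [Psi [[PhiK PsiK] PhiC PsiC PhiM PsiM]]].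
have [T [Tlin Tinj Tgen]] :=
  linear_intertwiner data1 data2 ext1 ext2 PhiK PsiK PhiC PsiC PhiM PsiM.
have [S [Slin Sinj Sgen]] :=
  linear_intertwiner data2 data1 ext2 ext1 PsiK PhiK PsiC PhiC PsiM PhiM.
(* Injections in both directions force equal dimensions, so both are bijective. *)
have dimT := linear_injection_dim Tlin Tinj.
have dimS := linear_injection_dim Slin Sinj.
have [phi1 iso1 gen1] :=
  intertwiner_isomorphism data1 Tlin (linear_injection_bij Tlin Tinj dimS) Tgen.
have [phi2 iso2 gen2] :=
  intertwiner_isomorphism data2 Slin (linear_injection_bij Slin Sinj dimT) Sgen.
by exists phi1, phi2.
Qed.
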